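(* Let $K=\mathbb{Q}(\sqrt{2})$ with ring of integers $O_K$, and let $$f_3(q):=\sum_{n=0}^{\infty}\frac{(q)_{2n}}{(-q)_{2n+1}}\,q^n.$$ Then $$q\,f_3(q^2)=\sum_{\mathbf{a}\subset O_K}\left(\frac{-4}{\mathcal{N}(\mathbf{a})}\right)q^{\mathcal{N}(\mathbf{a})},$$ where the sum runs over all nonzero ideals $\mathbf{a}$ of $O_K$ and $\left(\frac{c}{d}\right)$ denotes the Kronecker symbol.
   Context: Identities are between formal power series in $q$ (equivalently, for $|q|<1$). Notation: $(a)_n=(a;q)_n:=\prod_{j=0}^{n-1}(1-aq^j)$, so that $(q)_n=\prod_{j=1}^n(1-q^j)$ and $(-q)_n=\prod_{j=1}^n(1+q^j)$. For an ideal $\mathbf{a}$ of $O_K$, $\mathcal{N}(\mathbf{a})=|O_K/\mathbf{a}|$ is its norm. *)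

(* Defs.v *)
From HB Require Import structures.
From mathcomp Require Import all_boot all_order all_algebra all_field.
From mathcomp Require Import finmap boolp classical_sets functions.
From mathcomp Require Import cardinality fsbigop.

Set Implicit Arguments.
Unset Strict Implicit.
Unset Printing Implicit Defensive.

Import Order.TTheory GRing.Theory Num.Theory.

Local Open Scope ring_scope.

(* Formal power series: coef f m is the coefficient of q^m in f. *)
Record fps (R : Type) := Fps { coef : nat -> R }.

Section FpsRing.
Variable R : comUnitRingType.
Implicit Types f g h : fps R.

Lemma fpsP f g : coef f =1 coef g <-> f = g.
Proof.
split=> [|-> //]; case: f g => [f] [g] /= /funext fg; by congr Fps.
Qed.

HB.instance Definition _ := gen_eqMixin (fps R).
HB.instance Definition _ := gen_choiceMixin (fps R).

Definition fps_zero : fps R := Fps (fun=> 0).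
Definition fps_opp f : fps R := Fps (fun m => - coef f m).
Definition fps_add f g : fps R := Fps (fun m => coef f m + coef g m).
Definition fps_one : fps R := Fps (fun m => (m == 0%N)%:R).
Definition fps_mul f g : fps R :=
  Fps (fun m => \sum_(i < m.+1) coef f i * coef g (m - i)).

Fact fps_addA : associative fps_add.
Proof. by move=> f g h; apply/fpsP => m /=; rewrite addrA. Qed.
Fact fps_addC : commutative fps_add.
Proof. by move=> f g; apply/fpsP => m /=; rewrite addrC. Qed.
Fact fps_add0 : left_id fps_zero fps_add.
Proof. by move=> f; apply/fpsP => m /=; rewrite add0r. Qed.
Fact fps_addN : left_inverse fps_zero fps_opp fps_add.
Proof. by move=> f; apply/fpsP => m /=; rewrite addNr. Qed.

HB.instance Definition _ :=
  GRing.isZmodule.Build (fps R) fps_addA fps_addC fps_add0 fps_addN.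

Definition fps_trunc n f : {poly R} := \poly_(i < n) coef f i.

Lemma coef_fps_trunc n f i : (i < n)%N -> (fps_trunc n f)`_i = coef f i.
Proof. by move=> lt_in; rewrite coef_poly lt_in. Qed.

Lemma coef_fps_mul_poly n f g m (p r : {poly R}) : (m < n)%N ->
  (forall i, (i < n)%N -> p`_i = coef f i) ->
  (forall i, (i < n)%N -> r`_i = coef g i) ->
  coef (fps_mul f g) m = (p * r)`_m.
Proof.
move=> lt_mn Dp Dr; rewrite coefM; apply: eq_bigr => i _.
by rewrite Dp ?Dr // ?(leq_ltn_trans (leq_subr _ _)) // (leq_trans (ltn_ord i)).
Qed.

Fact fps_mulA : associative fps_mul.
Proof.
move=> f g h; apply/fpsP => m; pose T := fps_trunc m.+1.
have TE k i : (i < m.+1)%N -> (T k)`_i = coef k i by exact: coef_fps_trunc.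
have TM k l i : (i < m.+1)%N -> (T k * T l)`_i = coef (fps_mul k l) i.
  by move=> lt_im; rewrite (coef_fps_mul_poly lt_im (TE k) (TE l)).
rewrite (coef_fps_mul_poly (ltnSn m) (TE f) (TM g h)).
by rewrite (coef_fps_mul_poly (ltnSn m) (TM f g) (TE h)) mulrA.
Qed.

Fact fps_mulC : commutative fps_mul.
Proof.
move=> f g; apply/fpsP => m; pose T := fps_trunc m.+1.
have TE k i : (i < m.+1)%N -> (T k)`_i = coef k i by exact: coef_fps_trunc.
by rewrite !(coef_fps_mul_poly (ltnSn m) (TE _) (TE _)) mulrC.
Qed.

Fact fps_mul1 : left_id fps_one fps_mul.
Proof.
move=> f; apply/fpsP => m /=; rewrite big_ord_recl subn0 mul1r big1 ?addr0 //.
by move=> i _; rewrite mul0r.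
Qed.

Fact fps_mulDl : left_distributive fps_mul fps_add.
Proof.
move=> f g h; apply/fpsP => m /=; rewrite -big_split /=.
by apply: eq_bigr => i _; rewrite mulrDl.
Qed.

Fact fps_one_neq0 : fps_one != fps_zero.
Proof.
by apply/eqP => /fpsP /(_ 0%N) /= /eqP; rewrite oner_eq0.
Qed.

HB.instance Definition _ := GRing.Zmodule_isComNzRing.Build (fps R)
  fps_mulA fps_mulC fps_mul1 fps_mulDl fps_one_neq0.

Lemma coef_fps0 m : coef (0 : fps R) m = 0. Proof. by []. Qed.
Lemma coef_fpsN f m : coef (- f) m = - coef f m. Proof. by []. Qed.
Lemma coef_fpsD f g m : coef (f + g) m = coef f m + coef g m.
Proof. by []. Qed.
Lemma coef_fps1 m : coef (1 : fps R) m = (m == 0%N)%:R. Proof. by []. Qed.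
Lemma coef_fpsM f g m :
  coef (f * g) m = \sum_(i < m.+1) coef f i * coef g (m - i).
Proof. by []. Qed.
Lemma coef_fps_sum I r (P : pred I) (F : I -> fps R) m :
  coef (\sum_(i <- r | P i) F i) m = \sum_(i <- r | P i) coef (F i) m.
Proof. by elim/big_rec2: _ => // i x y _ <-. Qed.

Definition fps_const (c : R) : fps R := Fps (fun m => if m is 0 then c else 0).

Lemma coef_fps_constM c f m : coef (fps_const c * f) m = c * coef f m.
Proof.
rewrite coef_fpsM big_ord_recl subn0 big1 ?addr0 // => i _.
by rewrite mul0r.
Qed.

Definition fps_unit : {pred fps R} := fun f => coef f 0 \is a GRing.unit.

(* With c = coef f 0 and g = 1 - c^-1 f, which has no constant term, the      *)
(* inverse of f is c^-1 (1 + g + g^2 + ...); the terms g^k with k > m do not  *)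
(* contribute to the coefficient of q^m.                                      *)
Definition fps_inv f : fps R :=
  if coef f 0 \is a GRing.unit then
    let c' := fps_const (coef f 0)^-1 in
    c' * Fps (fun m => coef (\sum_(k < m.+1) (1 - c' * f) ^+ k) m)
  else f.

Lemma coef_fpsX_lt f k m : coef f 0 = 0 -> (m < k)%N -> coef (f ^+ k) m = 0.
Proof.
move=> f0; elim: k m => // k IHk m lt_mk; rewrite exprS coef_fpsM.
rewrite big1 // => i _.
case: (posnP i) => [-> | i_gt0]; first by rewrite f0 mul0r.
have le_im: (i <= m)%N by rewrite -ltnS.
have lt_mi: (m - i < m)%N by rewrite ltn_subrL i_gt0 (leq_trans i_gt0).
by rewrite IHk ?mulr0 // (leq_trans lt_mi) // -ltnS.
Qed.

Fact fps_mulVx : {in fps_unit, left_inverse 1 fps_inv *%R}.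
Proof.
move=> f Uf; rewrite /fps_inv ifT //.
set c' := fps_const _; set g := 1 - c' * f; set S := Fps _.
have g0 : coef g 0 = 0.
  by rewrite coef_fpsD coef_fpsN coef_fps_constM mulVr ?subrr.
have -> : c' * S * f = S * (1 - g) by rewrite /g opprB addrC subrK mulrCA mulrA.
apply/fpsP => m.
have -> : coef (S * (1 - g)) m = coef ((\sum_(k < m.+1) g ^+ k) * (1 - g)) m.
  rewrite !coef_fpsM; apply: eq_bigr => i _; congr (_ * _).
  rewrite /S /= !coef_fps_sum -!(big_mkord xpredT (fun k => coef (g ^+ k) i)).
  rewrite [RHS](big_cat_nat _ (n := i.+1)) //=.
  rewrite [X in _ = _ + X]big_nat_cond [X in _ = _ + X]big1 ?addr0 //.
  by move=> k; rewrite andbT => /andP[lt_ik _]; apply: coef_fpsX_lt.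
have -> : (\sum_(k < m.+1) g ^+ k) * (1 - g) = 1 - g ^+ m.+1.
  by rewrite -[1 in RHS](expr1n _ m.+1) subrXX mulrC; congr (_ * _);
     apply: eq_bigr => i _; rewrite expr1n mul1r.
by rewrite coef_fpsD coef_fpsN coef_fpsX_lt // subr0.
Qed.

Fact fps_unitPl f g : g * f = 1 -> fps_unit f.
Proof.
move=> /fpsP /(_ 0%N); rewrite coef_fpsM big_ord1 subn0 coef_fps1 eqxx => gf1.
by apply/unitrPr; exists (coef g 0); rewrite mulrC.
Qed.

Fact fps_inv_out : {in [predC fps_unit], fps_inv =1 id}.
Proof.
by move=> f nUf; rewrite /fps_inv ifN.
Qed.

HB.instance Definition _ := GRing.ComNzRing_hasMulInverse.Build (fps R)
  fps_mulVx fps_unitPl fps_inv_out.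

Definition fps_q : fps R := Fps (fun m => (m == 1%N)%:R).

Local Open Scope classical_set_scope.

(* Each power of q occurs in only finitely many members of the family. *)
Definition fps_summable (I : choiceType) (D : set I) (F : I -> fps R) : Prop :=
  forall m, finite_set [set i | D i /\ coef (F i) m <> 0].

(* The coefficientwise sum; meaningful only when the family is summable. *)
Definition fps_sum (I : choiceType) (D : set I) (F : I -> fps R) : fps R :=
  Fps (fun m => \sum_(i \in D) coef (F i) m).

End FpsRing.

Arguments fps_q {R}.
Arguments fps_mul : simpl never.
Arguments fps_inv : simpl never.

(* The q-Pochhammer symbol (a; q)_n *)
Definition qpoch (R : comPzRingType) (a q : R) (n : nat) : R :=
  \prod_(j < n) (1 - a * q ^+ j).

Definition f3_term (q : fps int) (n : nat) : fps int :=
  qpoch q q n.*2 / qpoch (- q) q n.*2.+1 * q ^+ n.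

(* The argument is any series without constant term, so that f3 (fps_q ^+ 2)  *)
(* is the result of substituting q^2 for q.                                   *)
Definition f3 (q : fps int) : fps int := fps_sum [set: nat]%classic (f3_term q).

Lemma qpoch_den_unit (q : fps int) n :
  coef q 0 = 0 -> qpoch (- q) q n \is a GRing.unit.
Proof.
move=> q0; rewrite /qpoch; elim/big_ind: _ => [|x y Ux Uy|j _].
- exact: unitr1.
- by rewrite unitrM Ux.
suff: coef (1 - - q * q ^+ j) 0 \is a GRing.unit by [].
rewrite mulNr opprK coef_fpsD [X in _ + X]coef_fpsM big_ord1 subn0.
by rewrite q0 mul0r addr0.
Qed.

Lemma f3_summable (q : fps int) :
  coef q 0 = 0 -> fps_summable [set: nat]%classic (f3_term q).
Proof.
move=> q0 m; apply: (sub_finite_set _ (finite_II m.+1)) => n [_].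
apply: contra_notT; rewrite -leqNgt => lt_mn.
rewrite /f3_term coef_fpsM big1 // => i _.
by rewrite coef_fpsX_lt ?mulr0 // (leq_ltn_trans (leq_subr _ _)).
Qed.

(* The Legendre symbol (c / p), for an odd prime p *)
Definition legendre (c : int) (p : nat) : int :=
  if (p %| c)%Z then 0
  else if [exists x : 'I_p, ((x : nat)%:Z ^+ 2 == c %[mod p])%Z] then 1 else -1.

Definition kronecker_prime (c : int) (p : nat) : int :=
  if p == 2%N then
    if (2 %| c)%Z then 0 else if (c %% 8)%Z \in [:: 1; 7] then 1 else -1
  else legendre c p.

(* The Kronecker symbol (c / d), for a natural number d *)
Definition kronecker (c : int) (d : nat) : int :=
  if d == 0%N then (`|c| == 1)%:R
  else \prod_(pe <- prime_decomp d) kronecker_prime c pe.1 ^+ pe.2.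

Section NumberField.
Variable K : fieldExtType rat.
Implicit Types a : set K.

Local Open Scope classical_set_scope.

Definition ring_of_integers : set K :=
  [set x | integralOver (intr : int -> K) x].

Local Notation OK := ring_of_integers.

Definition is_ideal a : Prop :=
  [/\ a `<=` OK, a 0,
      forall x y, a x -> a y -> a (x + y) &
      forall u x, OK u -> a x -> a (u * x)].

Definition nonzero_ideals : set (set K) :=
  [set a | is_ideal a /\ a <> [set 0]].

Definition quotient_set a : set (set K) :=
  [set [set x + y | y in a] | x in OK].

(* The index is finite for a nonzero ideal; the convention is 0 otherwise.    *)
Definition ideal_norm a : nat := #|` fset_set (quotient_set a)|%fset.

End NumberField.

Arguments ring_of_integers : clear implicits.
Arguments nonzero_ideals : clear implicits.

(* The subfield Q(sqrt 2) of the algebraic numbers, as an extension of Q *)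
Definition Qsqrt2 : fieldExtType rat :=
  tag (num_field_exists [:: sqrtC (2 : algC)]).

Lemma Qsqrt2_gen : exists2 s : Qsqrt2, s ^+ 2 = 2 & <<1; s>>%VS = fullv.
Proof.
rewrite /Qsqrt2; case: num_field_exists => K [KC [[|s [|//]] //= [Ks] genK]].
exists s; last by rewrite adjoin_seq1 in genK.
by apply: (fmorph_inj KC); rewrite rmorphXn /= Ks sqrtCK rmorph_nat.
Qed.

(* Main.v *)
Require Import Defs.
From mathcomp Require Import all_boot all_order all_algebra all_field.
From mathcomp Require Import finmap boolp.
From mathcomp Require Import classical_sets functions cardinality fsbigop.
From mathcomp Require Import ring zify.

Set Implicit Arguments.
Unset Strict Implicit.
Unset Printing Implicit Defensive.

Import Order.TTheory GRing.Theory Num.Theory.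

Local Open Scope ring_scope.

(** Both sides count the points of a cone in the lattice Z[sqrt 2], each with
    a sign.

    The q-series is a Hecke-type indefinite theta series:

      f3(q) = sum_(r >= 0) sum_(|j| <= r) (-1)^j q^(2 r^2 + 2 r - j^2).

    This is an instance of the Bailey lemma in base q^2.  One inverts
    1 / (-q; q)_(2n+1) as a sum over r <= n against the kernel
    1 / ((q^2; q^2)_(n-r) (q^2; q^2)_(n+r+1)) (lemma [bailey_pair]), exchanges
    the sums over n and r, and evaluates the sum over n >= r by the q-Gauss
    theorem, which here takes the rational value q^r / (1 - q^(2r+1)) (lemma
    [gauss_term_sum]).  Both are proved by creative telescoping, so that only
    finite sums occur; the tails of the q-Gauss sums contribute multiples of
    q^N, which do not affect a fixed coefficient for large N (lemma [hecke_partial_sum]).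
    Replacing q by q^2 and multiplying by q turns the exponent into
    (2r+1)^2 - 2 j^2, the norm of 2r+1 + j sqrt 2.

    On the other side, Z[sqrt 2] is norm-Euclidean, so every nonzero ideal is
    generated by some x + y sqrt 2, and its index is |x^2 - 2 y^2|
    ([ideal_is_principal], [ideal_norm_principal]).  The unit 1 + sqrt 2 of
    norm -1 makes the norm of the generator positive, and powers of the
    fundamental unit 3 + 2 sqrt 2 of norm 1 then move it into the cone
    2 |y| < x, at exactly one point if the norm is odd ([exists_reduced],
    [reduced_unique]).  So the ideals of odd norm correspond to the points
    2r+1 + j sqrt 2 with |j| <= r.  Finally (-4 / N) is the character of
    conductor 4 ([kronecker_m4]): it vanishes for even N, and for
    N = (2r+1)^2 - 2 j^2 it is (-1)^j. *)

(** * The Kronecker symbol (-4 / n) *)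

(** The primitive Dirichlet character of conductor 4. *)
Definition chi4 (n : nat) : int :=
  if (n %% 4 == 1)%N then 1 else if (n %% 4 == 3)%N then -1 else 0.

Lemma chi4M m n : chi4 (m * n) = chi4 m * chi4 n.
Proof.
rewrite /chi4 -modnMm.
have := ltn_pmod m (isT : 0 < 4)%N; have := ltn_pmod n (isT : 0 < 4)%N.
by move: (m %% 4)%N (n %% 4)%N => [|[|[|[|//]]]] [|[|[|[|//]]]] _ _.
Qed.

Lemma chi4X m e : chi4 (m ^ e) = chi4 m ^+ e.
Proof. by elim: e => // e IH; rewrite expnS chi4M IH exprS. Qed.

(** The first supplement to quadratic reciprocity, as 4 is a square.  With
    p - 1 = 2 h, Fermat gives (-1)^h = (-4)^h = x^(p-1) = 1 when x^2 = - 4.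
    Conversely some nonzero a satisfies a^h <> 1, because X^h - 1 has at most
    h roots; then a^h = - 1, and h = 2 k is even, so that 2 a^k is a square
    root of - 4. *)
Lemma sqrt_m4_Fp p : prime p -> odd p ->
  (exists x : 'F_p, x ^+ 2 = - 4) <-> (p %% 4 = 1)%N.
Proof.
move=> p_pr p_odd; have p_gt1 := prime_gt1 p_pr.
have fermat (x : 'F_p) : x != 0 -> x ^+ p.-1 = 1.
  move=> x0; apply: (mulfI x0); rewrite mulr1 -exprS prednK ?prime_gt0 //.
  by have := expf_card x; rewrite card_Fp.
have nz2 : (2 : 'F_p) != 0.
  by rewrite -(dvdn_pcharf (pchar_Fp p_pr)) dvdn_prime2 //; case: eqP p_odd => [->|].
have four : (4 : 'F_p) = 2 ^+ 2 by rewrite -natrX.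
pose h := p./2; have Dp : p.-1 = h.*2 by rewrite -[p in LHS]odd_double_half p_odd.
split=> [[x Dx] | p1].
  have x0 : x != 0.
    apply: contra_neq nz2 => x0; move: Dx; rewrite x0 expr0n /= => /esym/eqP.
    by rewrite oppr_eq0 four sqrf_eq0 => /eqP.
  have E : (-1) ^+ h = 1 :> 'F_p.
    have := fermat x x0; rewrite Dp -mul2n exprM Dx -[- 4]mulN1r exprMn.
    by rewrite four -exprM mul2n -Dp fermat ?mulr1.
  have h_even : ~~ odd h.
    apply/negP => h_odd; move: E; rewrite -signr_odd h_odd expr1 => /eqP.
    by rewrite -subr_eq0 -opprD oppr_eq0 (negPf nz2).
  lia.
have [k Dh] : exists k, h = k.*2 by exists (h./2); rewrite /h; lia.
have h_gt0 : (0 < h)%N by lia.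
have /existsP[a /andP[a0 ah]] : [exists a : 'F_p, (a != 0) && (a ^+ h != 1)].
  apply: contraT => /existsPn H.
  have := @max_poly_roots _ ('X^h - 1 : {poly 'F_p}) [seq a <- enum 'F_p | a != 0].
  rewrite -size_poly_eq0 size_XnsubC // filter_uniq ?enum_uniq // => /(_ isT).
  have -> : all (root ('X^h - 1)) [seq a <- enum 'F_p | a != 0].
    apply/allP => a; rewrite mem_filter => /andP[a0 _].
    have := H a; rewrite a0 /= negbK => /eqP ah.
    by rewrite /root !hornerE ah subrr.
  have -> : size [seq a <- enum 'F_p | a != 0] = p.-1.
    have := count_predC (pred1 0) (enum 'F_p).
    rewrite count_uniq_mem ?enum_uniq // mem_enum inE -cardT card_Fp //.
    by move/(congr1 predn) => /= <-; rewrite size_filter.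
  lia.
have ah1 : a ^+ h = -1.
  have : (a ^+ h) ^+ 2 = 1 by rewrite -exprM muln2 -Dp fermat.
  by move/eqP; rewrite sqrf_eq1 (negPf ah) => /eqP.
exists (2 * a ^+ k); rewrite exprMn -exprM muln2 -Dh ah1 mulrN1.
by rewrite four.
Qed.

Lemma kronecker_prime_m4 p : prime p -> kronecker_prime (-4) p = chi4 p.
Proof.
move=> p_pr; rewrite /kronecker_prime; case: eqP => [->//|p2].
have p_odd : odd p by case: (even_prime p_pr).
have p_gt1 := prime_gt1 p_pr.
rewrite /legendre ifN; last first.
  rewrite dvdzE /= (_ : 4 = 2 ^ 2)%N // Euclid_dvdX // dvdn_prime2 //.
  by apply/negP => /andP[/eqP].
have inFp (x : nat) : (x%:Z ^+ 2 == -4 %[mod p])%Z = ((x%:R : 'F_p) ^+ 2 == - 4).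
  rewrite eqz_mod_dvd opprK (_ : _ + 4 = (x ^ 2 + 4)%N%:Z); last first.
    by rewrite PoszD expr2 -mulnn PoszM.
  by rewrite dvdzE (dvdn_pcharf (pchar_Fp p_pr)) natrD natrX addr_eq0.
have [p1 | p1] := eqVneq (p %% 4)%N 1%N.
  have [x Dx] := (sqrt_m4_Fp p_pr p_odd).2 p1.
  rewrite /chi4 p1 ifT //; apply/existsP.
  have xp : (x < p)%N by rewrite -[X in (_ < X)%N](Fp_cast p_pr).
  by exists (Ordinal xp); rewrite inFp /= natr_Zp Dx.
rewrite /chi4 (negPf p1) ifN; last first.
  apply/existsP => -[x]; rewrite inFp => /eqP Dx; case/eqP: p1.
  by apply: (sqrt_m4_Fp p_pr p_odd).1; exists (x : nat)%:R.
by rewrite ifT //; apply/eqP; lia.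
Qed.

(** Both sides are multiplicative, so this reduces to the prime factors. *)
Lemma kronecker_m4 n : kronecker (-4) n = chi4 n.
Proof.
rewrite /kronecker; case: posnP => [->//|n_gt0].
rewrite [n in RHS]prod_prime_decomp //.
rewrite (big_morph chi4 chi4M (erefl : chi4 1 = 1)).
rewrite !big_seq; apply: eq_bigr => -[p e] /mem_prime_decomp[p_pr _ _] /=.
by rewrite kronecker_prime_m4 // chi4X.
Qed.

(** * A Bailey pair and a q-Gauss sum *)

Section QSeries.
Variables (R : comUnitRingType) (q : R).

(** This is q^(r^2) times the sum of (-1)^j q^(-j^2) over |j| <= r, with
    j = i - r; the factor q^(r^2) clears the negative powers of q. *)
Definition hecke_theta (r : nat) : R :=
  \sum_(i < r.*2.+1) (-1) ^+ (i + r) * q ^+ (i * (r.*2 - i)).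

Lemma hecke_theta0 : hecke_theta 0 = 1.
Proof. by rewrite /hecke_theta big_ord1 !expr0 mulr1. Qed.

Lemma hecke_thetaS r :
  hecke_theta r.+1 = q ^+ r.*2.+1 * hecke_theta r + 2 * (-1) ^+ r.+1.
Proof.
rewrite /hecke_theta doubleS big_ord_recl big_ord_recr /= /bump !add1n.
rewrite mul0n add0n subnn muln0 expr0 !mulr1 (exprD _ r.*2.+2) -doubleS.
have -> : (-1) ^+ r.+1.*2 = 1 :> R by rewrite -mul2n exprM sqrrN !expr1n.
rewrite mul1r mulr_sumr.
rewrite addrCA -mulr2n -[_ *+ 2]mulr_natl; congr (_ + _).
apply: eq_bigr => -[i lt_i] _ /=; rewrite add1n mulrCA -exprD; congr (_ * _ ^+ _).
  by rewrite addSnnS !addnS !exprS !mulN1r opprK.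
by move: lt_i; rewrite -mul2n; nia.
Qed.

(* The setting of power series without constant term, kept abstract: the
   identities below only need to invert 1 - q^k and 1 + q^k. *)
Hypothesis Um : forall k, 1 - q ^+ k.+1 \is a GRing.unit.
Hypothesis Up : forall k, 1 + q ^+ k.+1 \is a GRing.unit.

Definition inv_qpoch2 (k : nat) : R := (qpoch (q ^+ 2) (q ^+ 2) k)^-1.

Lemma inv_qpoch2_0 : inv_qpoch2 0 = 1.
Proof. by rewrite /inv_qpoch2 /qpoch big_ord0 invr1. Qed.

Lemma unit_qpoch_sq k : qpoch (q ^+ 2) (q ^+ 2) k \is a GRing.unit.
Proof.
elim: k => [|k IH]; rewrite /qpoch ?big_ord0 ?unitr1 // big_ord_recr /=.
by rewrite unitrM IH -exprS -exprM mul2n Um.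
Qed.

Lemma inv_qpoch2S k : inv_qpoch2 k = (1 - (q ^+ k.+1) ^+ 2) * inv_qpoch2 k.+1.
Proof.
have U : 1 - (q ^+ k.+1) ^+ 2 \is a GRing.unit by rewrite -exprM muln2 Um.
rewrite /inv_qpoch2 {2}/qpoch big_ord_recr /= -exprS [q ^+ 2 ^+ _]exprAC.
by rewrite invrM ?mulVKr ?unit_qpoch_sq // mulKVr.
Qed.

Lemma qpoch_q0 (a : R) : qpoch a q 0 = 1.
Proof. by rewrite /qpoch big_ord0. Qed.

Lemma qpochS (a : R) n : qpoch a q n.+1 = qpoch a q n * (1 - a * q ^+ n).
Proof. by rewrite /qpoch big_ord_recr. Qed.

(** The summand alpha_r / ((Q; Q)_(n-r) (a Q; Q)_(n+r)) of a Bailey pair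
    relative to a = Q, where Q = q^2.  Here alpha_r (1 - q^2) is
    q^(2 r^2 + r) (1 - q^(2r+1)) times the sum of (-1)^j q^(-j^2) over
    |j| <= r, and the factor 1 - q^2 is absorbed in the last denominator. *)
Definition bailey_term n r :=
  q ^+ (r * r.+1) * (1 - q ^+ r.*2.+1) * hecke_theta r *
  inv_qpoch2 (n - r) * inv_qpoch2 (n + r.+1).

(** The r-th summand of (1 + q^(2M)) (1 + q^(2M+1)) B_M - B_(M-1), where B_n
    is the sum of [bailey_term n].  The second term is written with the factor
    1 - q^(2(M-r)) instead of a shorter denominator, so that it vanishes at
    r = M, where B_(M-1) has no summand. *)
Definition bailey_defect M r :=
  q ^+ (r * r.+1) * (1 - q ^+ r.*2.+1) * hecke_theta r *
  inv_qpoch2 (M - r) * inv_qpoch2 (M + r.+1) *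
  ((1 + (q ^+ M) ^+ 2) * (1 + (q ^+ M) ^+ 2 * q) -
   (1 - (q ^+ (M - r)) ^+ 2) * (1 - (q ^+ (M + r.+1)) ^+ 2)).

(** The closed form comes from telescoping twice.  Write the defect as
    S_r (G_r - G_(r+1)), where S_r is the sum of (-1)^j q^(-j^2) over |j| <= r
    and G_r = q^(2M) q^(2 r^2) (q^r + q^(-r)) / ((Q)_(M-r) (Q)_(M+r)) with
    Q = q^2.  Summation by parts leaves the sum of (S_r - S_(r-1)) G_r, which for
    r >= 1 is (-1)^r q^(r^2) (q^r + q^(-r)) / ((Q)_(M-r) (Q)_(M+r)) up to a
    factor independent of r.  This is again a difference in r, with a
    denominator 1 - q^(2M) that the factor on the left clears. *)
Lemma bailey_defect_partial_sum M m : (m <= M)%N ->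
  (1 - (q ^+ M) ^+ 2) * \sum_(r < m) bailey_defect M r =
  - (q ^+ M) ^+ 2 * q ^+ (m * m.-1) * inv_qpoch2 (M - m) * inv_qpoch2 (M + m) *
  (hecke_theta m * (1 + (q ^+ m) ^+ 2) * (1 - (q ^+ M) ^+ 2)
   - 2 * (-1) ^+ m * ((q ^+ m) ^+ 2 - (q ^+ M) ^+ 2)).
Proof.
elim: m => [_|m IH lt_mM]; first by rewrite big_ord0 hecke_theta0; ring.
rewrite big_ord_recr /= mulrDr IH ?(ltnW lt_mM) //.
rewrite -[M](subnK lt_mM); move: (M - m.+1)%N => {lt_mM IH} k.
rewrite /bailey_defect hecke_thetaS !addnK -addSnnS addnK.
rewrite (inv_qpoch2S k) !addnS !addSn (inv_qpoch2S (k + m + m).+1).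
rewrite (_ : q ^+ (m * m.+1) = q ^+ (m * m.-1) * (q ^+ m) ^+ 2); last first.
  by rewrite -exprM -exprD; congr (_ ^+ _); case: (m) => [|j] //=; nia.
rewrite (_ : q ^+ (m.+1 * m) = q ^+ (m * m.-1) * (q ^+ m) ^+ 2); last first.
  by rewrite -exprM -exprD; congr (_ ^+ _); case: (m) => [|j] //=; nia.
rewrite -addnn !exprS !exprD.
ring.
Qed.

(** The last summand r = M cancels the closed form of the others. *)
Lemma bailey_defect_sum M : (0 < M)%N -> \sum_(r < M.+1) bailey_defect M r = 0.
Proof.
case: M => // M _.
have U : 1 - (q ^+ M.+1) ^+ 2 \is a GRing.unit by rewrite -exprM muln2 Um.
apply: (mulrI U).
rewrite mulr0 big_ord_recr /= mulrDr bailey_defect_partial_sum //.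
rewrite /bailey_defect !subnn inv_qpoch2_0 !addnS !addSn (inv_qpoch2S (M + M).+2).
rewrite (_ : q ^+ (M.+1 * M.+2) = q ^+ (M.+1 * M) * (q ^+ M.+1) ^+ 2); last first.
  by rewrite -exprM -exprD; congr (_ ^+ _); nia.
rewrite doubleS -addnn !exprS !exprD expr0; ring.
Qed.

(** The vanishing of the total defect is the recurrence
    (1 + q^(2n+2)) (1 + q^(2n+3)) B_(n+1) = B_n, which the right-hand side
    satisfies by definition. *)
Lemma bailey_pair n :
  \sum_(r < n.+1) bailey_term n r = (qpoch (- q) q n.*2.+1)^-1.
Proof.
have Uq k : qpoch (- q) q k \is a GRing.unit.
  elim: k => [|k IH]; first by rewrite qpoch_q0 unitr1.
  by rewrite qpochS unitrM IH mulNr opprK -exprS Up.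
elim: n => [|n IH].
  rewrite big_ord1 /bailey_term hecke_theta0 inv_qpoch2_0 qpochS qpoch_q0 expr0.
  have U1 : 1 + q \is a GRing.unit by rewrite -[q]expr1 Up.
  have U2 : 1 - q \is a GRing.unit by rewrite -[q]expr1 Um.
  have -> : inv_qpoch2 1 = ((1 - q) * (1 + q))^-1.
    by rewrite /inv_qpoch2 /qpoch big_ord1; congr (_^-1); ring.
  by rewrite mulNr opprK invrM // !mul1r !mulr1 mulrCA divrr // mulr1.
have : \sum_(r < n.+2) bailey_defect n.+1 r = 0 by apply: bailey_defect_sum.
set C := (1 + (q ^+ n.+1) ^+ 2) * (1 + (q ^+ n.+1) ^+ 2 * q).
have -> : \sum_(r < n.+2) bailey_defect n.+1 r =
  C * \sum_(r < n.+2) bailey_term n.+1 r - \sum_(r < n.+1) bailey_term n r.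
  rewrite mulr_sumr big_ord_recr [X in _ = X - _]big_ord_recr /=.
  rewrite addrAC -sumrB; congr (_ + _).
    apply: eq_bigr => -[r /= lt_rn] _.
    rewrite /bailey_defect /bailey_term -/C (@subSn r n lt_rn) addSn.
    rewrite (inv_qpoch2S (n - r)) (inv_qpoch2S (n + r.+1)); ring.
  by rewrite /bailey_defect /bailey_term -/C subnn; ring.
rewrite IH => /eqP; rewrite subr_eq0 => /eqP E.
have UC : C \is a GRing.unit.
  by rewrite unitrM -exprM muln2 Up -exprSr Up.
apply: (mulrI UC); rewrite E doubleS (qpochS _ n.*2.+2) (qpochS _ n.*2.+1).
have EC : (1 - - q * q ^+ n.*2.+1) * (1 - - q * q ^+ n.*2.+2) = C.
  by rewrite /C -exprM muln2 doubleS !mulNr !opprK -!exprS -exprSr mulrC.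
by rewrite -mulrA EC invrM // mulVKr.
Qed.

(** The summand, at n = r + m, of
    (1 - q^(2r+1)) q^(-r) sum_(n >= r) (q; q)_(2n) q^n
      / ((Q; Q)_(n-r) (Q; Q)_(n+r+1)) with Q = q^2.  By the q-Gauss theorem the
    infinite sum is 1. *)
Definition gauss_term r m := qpoch q q (r + m).*2 * q ^+ m * inv_qpoch2 m *
  inv_qpoch2 (r.*2 + m).+1 * (1 - q ^+ r.*2.+1).

(** A Wilf-Zeilberger pair: the difference of the summands for r + 1 and r at
    the same n is a difference in n.  As n = r + m, the two sums run
    up to the same n although their lengths differ by one. *)
Lemma gauss_term_sum_step r K :
  \sum_(m < K) gauss_term r.+1 m = \sum_(m < K.+1) gauss_term r m
    - (1 + (q ^+ r.+1) ^+ 2) * qpoch q q (r + K).+1.*2 * q ^+ K * inv_qpoch2 K *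
      inv_qpoch2 (r.*2 + K).+2.
Proof.
elim: K => [|K IH].
  rewrite big_ord0 big_ord1 /gauss_term !addn0 inv_qpoch2_0 doubleS !qpochS (inv_qpoch2S r.*2.+1).
  rewrite -addnn !exprS exprD expr0; ring.
rewrite big_ord_recr /= IH [in RHS]big_ord_recr /= -!addrA; congr (_ + _).
rewrite /gauss_term !addnS !doubleS !addSn !qpochS (inv_qpoch2S K).
rewrite (inv_qpoch2S (r.*2 + K).+2) doubleD -!addnn !exprS !exprD; ring.
Qed.

(** The q-Gauss sum with its tail.  For r = 0 the partial sums have the closed
    form 1 - q^K (q; q)_(2K) / (Q; Q)_K^2, and the passage from r to r + 1
    shortens them by one term and changes them by a multiple of q^K. *)
Lemma gauss_term_sum r K : exists x,
  \sum_(m < K) gauss_term r m = 1 + q ^+ K * x.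
Proof.
elim: r K => [|r IH] K.
  exists (- qpoch q q K.*2 * inv_qpoch2 K ^+ 2); elim: K => [|K IH].
    by rewrite big_ord0 inv_qpoch2_0 qpoch_q0; ring.
  rewrite big_ord_recr /= IH /gauss_term add0n doubleS !qpochS (inv_qpoch2S K).
  by rewrite -addnn !exprS !exprD expr0; ring.
have [x Dx] := IH K.+1; rewrite gauss_term_sum_step Dx.
exists (q * x - (1 + (q ^+ r.+1) ^+ 2) * qpoch q q (r + K).+1.*2 * inv_qpoch2 K *
      inv_qpoch2 (r.*2 + K).+2).
by rewrite exprS; ring.
Qed.

Lemma exchange_triangle (F : nat -> nat -> R) N :
  \sum_(n < N) \sum_(r < n.+1) F n r =
  \sum_(r < N) \sum_(m < N - r) F (r + m)%N r.
Proof.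
elim: N => [|N IH]; first by rewrite !big_ord0.
rewrite big_ord_recr /= IH [RHS]big_ord_recr /= big_ord_recr /= addrA.
rewrite subSnn big_ord1 addn0; congr (_ + _); rewrite -big_split /=.
apply: eq_bigr => -[r /= lt_rN] _.
by rewrite subSn ?(ltnW lt_rN) // big_ord_recr /= subnKC // ltnW.
Qed.

(** The Bailey lemma in truncated form: insert [bailey_pair], exchange the sums
    and apply the q-Gauss sum.  The error for the index r is a multiple of
    q^(N-r), and it comes with a factor q^r. *)
Lemma hecke_partial_sum N : exists x,
  \sum_(n < N) qpoch q q n.*2 / qpoch (- q) q n.*2.+1 * q ^+ n =
  \sum_(r < N) q ^+ (r * r.+2) * hecke_theta r + q ^+ N * x.
Proof.
have [y Dy] := boolp.choice (fun r => gauss_term_sum r (N - r)).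
exists (\sum_(r < N) q ^+ (r * r.+1) * hecke_theta r * y r).
under eq_bigr => n _ do rewrite -bailey_pair mulr_sumr mulr_suml.
rewrite (exchange_triangle
  (fun n r => qpoch q q n.*2 * bailey_term n r * q ^+ n)) mulr_sumr -big_split /=.
apply: eq_bigr => -[r /= lt_rN] _.
have -> : q ^+ N = q ^+ (N - r) * q ^+ r by rewrite -exprD subnK // ltnW.
rewrite (mulnS r r.+1) exprD.
transitivity (q ^+ (r * r.+1) * hecke_theta r * q ^+ r * \sum_(m < N - r) gauss_term r m).
  rewrite mulr_sumr; apply: eq_bigr => m _.
  rewrite /bailey_term /gauss_term addKn.
  have -> : (r + m + r.+1 = (r.*2 + m).+1)%N by lia.
  by rewrite !exprD; ring.
by rewrite Dy; ring.
Qed.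
End QSeries.

(** * The coefficients of f3 *)

Lemma coef_fps0M (R : comUnitRingType) (f g : fps R) :
  coef (f * g) 0 = coef f 0 * coef g 0.
Proof. by rewrite coef_fpsM big_ord1. Qed.

Lemma coef_fps_qXM (R : comUnitRingType) k (f : fps R) m :
  coef (fps_q ^+ k * f) m = if (m < k)%N then 0 else coef f (m - k).
Proof.
elim: k m => [|k IH] m; first by rewrite mul1r subn0.
rewrite exprS -mulrA coef_fpsM.
case: m => [|m]; first by rewrite big_ord1 [LHS]mul0r.
rewrite 2!big_ord_recl big1 => [|i _]; last exact: mul0r.
rewrite addr0 [X in X + _]mul0r add0r [X in X = _]mul1r IH.
by rewrite lift0 subSS subn0.
Qed.

Lemma coef_fps_qX (R : comUnitRingType) k m :
  coef (fps_q ^+ k : fps R) m = (m == k)%:R.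
Proof.
by rewrite -[_ ^+ _]mulr1 coef_fps_qXM; case: ltngtP => // [lt|->];
  rewrite coef_fps1 ?subnn // -(inj_eq (@addnI k)) subnKC 1?ltnW // addn0 gtn_eqF.
Qed.

Lemma coef_sqX_mul_small (f : fps int) (q0 : fps int) N m :
  coef q0 0 = 0 -> (m < N)%N -> coef (q0 ^+ N * f) m = 0.
Proof.
move=> q00 lt_mN; rewrite coef_fpsM big1 // => -[i /= lt_i] _.
by rewrite coef_fpsX_lt ?mul0r // (leq_trans lt_i).
Qed.

Lemma coef_f3 (q0 : fps int) N m : coef q0 0 = 0 -> (m < N)%N ->
  coef (f3 q0) m = \sum_(r < N) coef (q0 ^+ (r * r.+2) * hecke_theta q0 r) m.
Proof.
move=> q00 lt_mN.
have qX0 k : coef (q0 ^+ k.+1) 0 = 0 by rewrite exprS coef_fps0M q00 mul0r.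
have Um k : 1 - q0 ^+ k.+1 \is a GRing.unit.
  suff: coef (1 - q0 ^+ k.+1) 0 \is a GRing.unit by [].
  by rewrite coef_fpsD coef_fpsN qX0.
have Up k : 1 + q0 ^+ k.+1 \is a GRing.unit.
  suff: coef (1 + q0 ^+ k.+1) 0 \is a GRing.unit by [].
  by rewrite coef_fpsD qX0.
have [x Dx] := hecke_partial_sum Um Up N.
rewrite -coef_fps_sum -[RHS]addr0 -(coef_sqX_mul_small x q00 lt_mN).
rewrite -coef_fpsD -Dx coef_fps_sum /f3 /=.
rewrite (fsbig_ord _ _ (fun n => coef (f3_term q0 n) m)).
apply/esym/fsbig_widen => // n [_ /negP]; rewrite -leqNgt => le_Nn.
change (coef (f3_term q0 n) m = 0); rewrite /f3_term mulrC.
by rewrite coef_sqX_mul_small // (leq_trans lt_mN).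
Qed.

(** The norm (2r+1)^2 - 2 j^2 of 2r+1 + j sqrt 2 for j = i - r; see
    [qnorm_cone]. *)
Definition cone_norm (r i : nat) : nat := ((r * r.+2 + i * (r.*2 - i)).*2.+1)%N.

Lemma coef_q_f3 m : coef (fps_q * f3 (fps_q ^+ 2)) m =
  \sum_(r < m) \sum_(i < r.*2.+1) (-1) ^+ (i + r) * (cone_norm r i == m)%:R.
Proof.
rewrite -[fps_q in X in X * _]expr1 coef_fps_qXM.
case: m => [|m]; first by rewrite big_ord0.
rewrite ltnS ltn0 subSS subn0 (@coef_f3 _ m.+1) //; last by rewrite coef_fps_qX.
apply: eq_bigr => r _; rewrite /hecke_theta mulr_sumr coef_fps_sum.
apply: eq_bigr => i _; rewrite mulrCA -exprD -exprM.
have -> : (-1) ^+ (i + r) = fps_const ((-1) ^+ (i + r)) :> fps int.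
  rewrite -signr_odd -[in RHS]signr_odd; case: odd; apply/fpsP => -[|k] //.
by rewrite coef_fps_constM coef_fps_qX /cone_norm eqSS eq_sym mul2n.
Qed.

(** * The norm form x^2 - 2 y^2 *)

(** Compare the parities of the 2-adic valuations. *)
Lemma sqrt2_irrational (x y : int) : x ^+ 2 = 2 * y ^+ 2 -> y = 0.
Proof.
move=> /(congr1 absz); rewrite abszM !abszX => E; apply/eqP; rewrite -absz_eq0.
apply: contra_eqT E; rewrite -lt0n => y_gt0.
apply/eqP => E; have x_gt0 : (0 < `|x|)%N.
  by rewrite lt0n; apply: contra_eqN E => /eqP->; rewrite eq_sym muln_eq0 expn_eq0; lia.
have := congr1 (fun n => odd (logn 2 n)) E.
by rewrite /= lognM ?expn_gt0 ?y_gt0 // !lognX oddD !oddM.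
Qed.

Definition qnorm (a b : int) : int := a ^+ 2 - 2 * b ^+ 2.

Lemma qnorm_eq0 a b : qnorm a b = 0 -> a = 0 /\ b = 0.
Proof.
move=> /eqP; rewrite subr_eq0 => /eqP E; have b0 := sqrt2_irrational E.
by move: E; rewrite b0 expr0n mulr0 => /eqP; rewrite sqrf_eq0 => /eqP.
Qed.

Lemma qnormM a b c d :
  qnorm (a * c + 2 * b * d) (a * d + b * c) = qnorm a b * qnorm c d.
Proof. by rewrite /qnorm; ring. Qed.

Lemma nearest_multiple (u n : int) : n != 0 ->
  exists k : int, 4 * (u - k * n) ^+ 2 <= n ^+ 2.
Proof.
suff pos m : 0 < m -> exists k : int, 4 * (u - k * m) ^+ 2 <= m ^+ 2.
  move=> n0; case: (ltgtP n 0) n0 => // [n_lt0|n_gt0] _; last exact: pos.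
  have [|k Hk] := pos (- n); first by rewrite oppr_gt0.
  by exists (- k); move: Hk; rewrite sqrrN mulrN mulNr.
move=> m_gt0; have m20 : 2 * m != 0 by lia.
exists ((2 * u + m) %/ (2 * m))%Z; set k := (_ %/ _)%Z.
have := divz_eq (2 * u + m) (2 * m); rewrite -/k.
have := modz_ge0 (2 * u + m) m20; have := ltz_mod (2 * u + m) m20.
set t := (_ %% _)%Z => lt_t t_ge0 E.
have lo : - m <= 2 * (u - k * m) by lia.
have hi : 2 * (u - k * m) <= m by lia.
have : 0 <= (m - 2 * (u - k * m)) * (m + 2 * (u - k * m)).
  by apply: mulr_ge0; lia.
by set w := u - k * m; nia.
Qed.

(** Divide c + d sqrt 2 by a + b sqrt 2 in Q(sqrt 2) and round both
    coordinates.  The error has coordinates of absolute value at most 1/2, so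
    its norm lies between -1/2 and 1/4. *)
Lemma norm_euclidean (a b c d : int) : qnorm a b != 0 -> exists k l : int,
  (`|qnorm (c - (k * a + 2 * l * b)) (d - (k * b + l * a))| < `|qnorm a b|)%N.
Proof.
set n := qnorm a b => n0.
have [k Hk] := nearest_multiple (c * a - 2 * d * b) n0.
have [l Hl] := nearest_multiple (d * a - c * b) n0.
exists k, l; set N := qnorm _ _.
have E : N * n = (c * a - 2 * d * b - k * n) ^+ 2
               - 2 * (d * a - c * b - l * n) ^+ 2.
  by rewrite /N /n /qnorm; ring.
move: Hk Hl E; set U := _ - k * n; set V := _ - l * n => Hk Hl E.
have n2 : 0 < n ^+ 2 by rewrite exprn_even_gt0.
have lt_n : (`|N| * `|n|)%R < `|n| * `|n|.
  rewrite -!normrM E -expr2 (ger0_norm (ltW n2)) ltr_norml.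
  by apply/andP; split; have := sqr_ge0 U; have := sqr_ge0 V; lia.
by move: lt_n; rewrite ltr_pM2r ?normr_gt0 //; lia.
Qed.

(** * Integers and ideals of Q(sqrt 2) *)

Section Field.
Variables (K : fieldExtType rat) (s : K).
Hypotheses (s2 : s ^+ 2 = 2) (genK : <<1; s>>%VS = fullv).

Lemma indep_1s (a b : rat) : a%:A + b%:A * s = 0 -> a = 0 /\ b = 0.
Proof.
move=> E; have [b0|b0] := eqVneq b 0.
  move: E; rewrite b0 scale0r mul0r addr0 => /eqP.
  by rewrite scaler_eq0 oner_eq0 orbF => /eqP.
have Ds : s = (- a / b)%:A.
  apply: (mulfI (x := b%:A)); first by rewrite scaler_eq0 oner_eq0 orbF.
  rewrite -!in_algE -rmorphM /= (mulrC b) divfK // scaleNr; apply/eqP.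
  by rewrite -addr_eq0 addrC E.
have E2 : (- a / b) ^+ 2 = 2.
  apply: (fmorph_inj (in_alg K)).
  by rewrite rmorphXn rmorph_nat /= -Ds.
set c := - a / b in E2.
suff /sqrt2_irrational/eqP : numq c ^+ 2 = 2 * denq c ^+ 2.
  by rewrite (negPf (denq_neq0 c)).
apply: (@intr_inj rat); rewrite !expr2 !intrM -!expr2.
rewrite -[2%:~R]E2 -{2}[c]divq_num_den expr_div_n divfK //.
by rewrite expf_neq0 // intr_eq0 denq_neq0.
Qed.

(** Evaluation commutes with the conjugation s |-> - s.  Stating this for
    evaluations avoids the construction of the conjugation as an
    automorphism of K. *)
Lemma horner_conj (p : {poly rat}) (a b : rat) : exists u v : rat,
  (map_poly (in_alg K) p).[a%:A + b%:A * s] = u%:A + v%:A * s /\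
  (map_poly (in_alg K) p).[a%:A - b%:A * s] = u%:A - v%:A * s.
Proof.
elim/poly_ind: p => [|p c [u [v [Eu Ev]]]].
  by exists 0, 0; rewrite rmorph0 !horner0 !scale0r mul0r addr0 subr0.
exists (u * a + 2 * v * b + c), (u * b + v * a).
rewrite -!in_algE in Eu Ev *; rewrite !(rmorphD, rmorphM).
rewrite rmorph1 /= map_polyX map_polyC /= -!in_algE !hornerE Eu Ev.
set A := in_alg K a; set B := in_alg K b.
set U := in_alg K u; set V := in_alg K v; set C := in_alg K c.
by split; ring: s2.
Qed.

Lemma coord_1s x : exists a b : rat, x = a%:A + b%:A * s.
Proof.
have : x \in <<1; s>>%VS by rewrite genK memvf.
case/Fadjoin_polyP => p /polyOver1P[r ->] ->.
have [a [b [E _]]] := horner_conj r 0 1.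
by exists a, b; rewrite -E scale0r scale1r add0r mul1r.
Qed.

Lemma in_alg_int (z : int) : (z%:~R : rat)%:A = z%:~R :> K.
Proof. by rewrite -in_algE rmorph_int. Qed.

Lemma map_poly_int_in_alg (p : {poly int}) :
  map_poly (in_alg K) (map_poly intr p) = map_poly intr p.
Proof. by rewrite -map_poly_comp; apply: eq_map_poly; apply: in_alg_int. Qed.

Lemma integral_conj (a b : rat) :
  integralOver (intr : int -> K) (a%:A + b%:A * s) ->
  integralOver (intr : int -> K) (a%:A - b%:A * s).
Proof.
case=> p mon_p rp; exists p => //.
move: rp; rewrite -map_poly_int_in_alg !/root.
have [u [v [-> ->]]] := horner_conj (map_poly intr p) a b.
by move/eqP/indep_1s => [-> ->]; rewrite !scale0r mul0r subr0.
Qed.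

Lemma integral_rat (a : rat) : integralOver (intr : int -> K) a%:A ->
  exists z : int, a = z%:~R.
Proof.
case=> p mon_p rp.
have rQ : root (map_poly (intr : int -> rat) p) a.
  by rewrite -(fmorph_root (in_alg K)) map_poly_int_in_alg.
suff : (ratr a : algC) \in Num.int.
  case/intrP => z Dz; exists z; apply: (fmorph_inj (@ratr algC)).
  by rewrite /= Dz ratr_int.
apply: Cint_rat_Aint; first exact: Crat_rat.
apply: (@root_monic_Aint (map_poly intr p)).
- have -> : map_poly (intr : int -> algC) p =
      map_poly (@ratr algC) (map_poly (intr : int -> rat) p).
    by rewrite -map_poly_comp; apply: eq_map_poly => z /=; rewrite ratr_int.
  by rewrite fmorph_root.
- by rewrite monic_map.
- by apply/polyOverP => i; rewrite coef_map /= intr_int.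
Qed.

Definition quad (a b : int) : K := a%:~R + b%:~R * s.

Lemma parity_int (c : int) : exists d : int, c = 2 * d \/ c = 2 * d + 1.
Proof.
exists (c %/ 2)%Z; have := divz_eq c 2; have := modz_ge0 c (isT : (2 : int) != 0).
have := ltz_mod c (isT : (2 : int) != 0); lia.
Qed.

(** The 2-adic part of the computation of the ring of integers: A = 2a and
    C = 4b are the numbers whose integrality follows from that of
    x = a + b sqrt 2, and n is the norm of x. *)
Lemma coord_divisibility (A C n : int) : 2 * A ^+ 2 - C ^+ 2 = 8 * n ->
  exists a b : int, A = 2 * a /\ C = 4 * b.
Proof.
move=> E; have [D [DC|DC]] := parity_int C; last by exfalso; nia.
have [a [Da|Da]] := parity_int A; last by exfalso; nia.
have [b [Db|Db]] := parity_int D; last by exfalso; nia.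
by exists a, b; lia.
Qed.

Lemma integral_s : integralOver (intr : int -> K) s.
Proof.
exists ('X^2 - (2 : int)%:P).
  by rewrite monicE lead_coefDl ?lead_coefXn // size_opp size_polyC size_polyXn.
rewrite rmorphB /= map_polyXn map_polyC /= /root !hornerE s2.
by rewrite subrr.
Qed.

(** For x = a + b s with conjugate y, the numbers x + y = 2 a, (x - y) s = 4 b
    and x y = a^2 - 2 b^2 are rational and integral, hence integers. *)
Lemma integral_rat_coord (a b : rat) :
  integralOver (intr : int -> K) (a%:A + b%:A * s) ->
  exists c d : int, a = c%:~R /\ b = d%:~R.
Proof.
move=> Ix; have Iy := integral_conj Ix.
have [A DA] : exists A : int, 2 * a = A%:~R.
  apply: integral_rat; have := integral_add Ix Iy.
  by congr (integralOver _ _); rewrite -!in_algE rmorphM rmorph_nat; ring.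
have [C DC] : exists C : int, 4 * b = C%:~R.
  apply: integral_rat; have := integral_mul (integral_sub Ix Iy) integral_s.
  by congr (integralOver _ _); rewrite -!in_algE rmorphM rmorph_nat; ring: s2.
have [n Dn] : exists n : int, a ^+ 2 - 2 * b ^+ 2 = n%:~R.
  apply: integral_rat; have := integral_mul Ix Iy.
  congr (integralOver _ _); rewrite !expr2 -!in_algE rmorphB !rmorphM rmorph_nat.
  by ring: s2.
have /coord_divisibility [c [d [Ec Ed]]] : 2 * A ^+ 2 - C ^+ 2 = 8 * n.
  apply: (@intr_inj rat); rewrite !expr2 !(intrD, intrM, mulrNz) -DA -DC -Dn.
  by rewrite !mulr1z; ring.
exists c, d; split.
  by apply: (mulfI (isT : (2 : rat) != 0)); rewrite DA Ec intrM.
by apply: (mulfI (isT : (4 : rat) != 0)); rewrite DC Ed intrM.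
Qed.

Lemma integersP x : ring_of_integers K x <-> exists a b : int, x = quad a b.
Proof.
split=> [Ix | [a [b ->]]]; last first.
  apply: integral_add; first exact: integral_id.
  by apply: integral_mul; [exact: integral_id | exact: integral_s].
have [a [b Dx]] := coord_1s x; move: Ix; rewrite Dx => /integral_rat_coord.
by move=> [c [d [-> ->]]]; exists c, d; rewrite !in_alg_int.
Qed.

Lemma quad_inj a b c d : quad a b = quad c d -> a = c /\ b = d.
Proof.
move=> /eqP; rewrite -subr_eq0 => /eqP E.
have [] := @indep_1s (a - c)%:~R (b - d)%:~R.
  by rewrite !in_alg_int -E /quad !intrD !mulrNz; ring.
by move=> /eqP; rewrite intr_eq0 subr_eq0 => /eqP-> /eqP;
   rewrite intr_eq0 subr_eq0 => /eqP->.
Qed.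

Lemma quadM a b c d :
  quad a b * quad c d = quad (a * c + 2 * b * d) (a * d + b * c).
Proof. by rewrite /quad !(intrD, intrM); ring: s2. Qed.

Lemma quadD a b c d : quad a b + quad c d = quad (a + c) (b + d).
Proof. by rewrite /quad !(intrD, intrM); ring. Qed.

Lemma quadN a b : - quad a b = quad (- a) (- b).
Proof. by rewrite /quad !mulrNz; ring. Qed.

Lemma quadB a b c d : quad a b - quad c d = quad (a - c) (b - d).
Proof. by rewrite quadN quadD. Qed.

Lemma quad_eq0 a b : quad a b = 0 <-> a = 0 /\ b = 0.
Proof.
have quad0 : quad 0 0 = 0 by rewrite /quad mul0r addr0.
by split=> [|[-> ->//]]; rewrite -quad0 => /quad_inj.
Qed.

Definition principal (x : K) : set K :=
  [set u * x | u in ring_of_integers K]%classic.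

Lemma integers_quad a b : ring_of_integers K (quad a b).
Proof. by apply/integersP; exists a, b. Qed.

Lemma principal_quadP a b c d : principal (quad a b) (quad c d) <->
  exists u v, c = u * a + 2 * v * b /\ d = u * b + v * a.
Proof.
split=> [[x /integersP[u [v ->]]] | [u [v [-> ->]]]]; last first.
  by exists (quad u v); [exact: integers_quad | rewrite quadM].
by rewrite quadM => /quad_inj[<- <-]; exists u, v.
Qed.

Lemma principal_sub (a : set K) x :
  is_ideal a -> a x -> (principal x `<=` a)%classic.
Proof. by move=> [_ _ _ aM] ax _ [u Ou <-]; apply: aM. Qed.

Lemma idealB (a : set K) x y : is_ideal a -> a x -> a y -> a (x - y).
Proof.
move=> [aO a0 aD aM] ax ay; apply: aD => //.
have -> : - y = quad (-1) 0 * y by rewrite /quad mul0r addr0 mulNr mul1r.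
by apply: aM => //; apply: integers_quad.
Qed.

Lemma integersD x y : ring_of_integers K x -> ring_of_integers K y ->
  ring_of_integers K (x + y).
Proof. exact: integral_add. Qed.

Lemma integersM x y : ring_of_integers K x -> ring_of_integers K y ->
  ring_of_integers K (x * y).
Proof. exact: integral_mul. Qed.

Lemma principal_ideal x : ring_of_integers K x -> is_ideal (principal x).
Proof.
move=> Ox; split.
- by move=> _ [u Ou <-]; apply: integersM.
- by exists 0; [exact: integral0 | rewrite mul0r].
- by move=> _ _ [u Ou <-] [v Ov <-]; exists (u + v);
    [exact: integersD | rewrite mulrDl].
- by move=> w _ Ow [u Ou <-]; exists (w * u);
    [exact: integersM | rewrite mulrA].
Qed.

(** An element of minimal nonzero norm generates, by Euclidean division. *)
Lemma ideal_is_principal (a : set K) : nonzero_ideals K a ->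
  exists x y, qnorm x y != 0 /\ a = principal (quad x y).
Proof.
move=> [Ia a_neq0]; have [aO a0 _ aM] := Ia.
pose P n := `[< exists x y, [/\ a (quad x y), qnorm x y != 0 & n = `|qnorm x y|%N] >].
have exP : exists n, P n.
  have [z [az z0]] : exists z, a z /\ z <> 0.
    apply: contrapT => H; apply: a_neq0; rewrite eqEsubset; split=> z.
      by move=> az; apply: contrapT => z0; apply: H; exists z.
    by move=> ->.
  have [x [y Dz]] := (integersP z).1 (aO _ az).
  exists `|qnorm x y|%N; apply/asboolP; exists x, y; split=> //.
    by rewrite -Dz.
  by apply/eqP => /qnorm_eq0 /quad_eq0; rewrite -Dz.
case: (ex_minnP exP) => n /asboolP[x [y [axy n0 Dn]]] n_min.
exists x, y; split=> //; rewrite eqEsubset; split; last exact: principal_sub.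
move=> z az; have [c [d Dz]] := (integersP z).1 (aO _ az).
have [k [l]] := norm_euclidean c d n0; rewrite -Dn ltnNge => /negP lt_n.
rewrite Dz; apply/principal_quadP; exists k, l.
set e := (X in qnorm X _) in lt_n; set f := (X in qnorm _ X) in lt_n.
have aef : a (quad e f).
  rewrite /e /f -quadB -quadM -Dz; apply: idealB => //.
  by apply: aM => //; apply: integers_quad.
have [/qnorm_eq0[e0 f0]|ef0] := eqVneq (qnorm e f) 0.
  by split; apply/eqP; rewrite -subr_eq0; apply/eqP.
by case: lt_n; apply: n_min; apply/asboolP; exists e, f.
Qed.

Lemma ideal_norm_reps (a : set K) (reps : seq K) : is_ideal a -> uniq reps ->
  (forall x, x \in reps -> ring_of_integers K x) ->
  (forall x, ring_of_integers K x -> exists2 y, y \in reps & a (x - y)) ->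
  {in reps &, forall x y, a (x - y) -> x = y} ->
  ideal_norm a = size reps.
Proof.
move=> Ia Ur rO cover inj; have [aO a0 aD aM] := Ia.
pose coset x : set K := [set x + y | y in a]%classic.
have cosetP x y : coset x = coset y -> a (x - y).
  move=> E; have : coset y x by rewrite -E; exists 0; rewrite ?addr0.
  by case=> z az <-; rewrite addrAC subrr add0r.
have cosetE x y : a (x - y) -> (coset x `<=` coset y)%classic.
  move=> axy _ [z az <-]; exists (x - y + z); first exact: aD.
  by rewrite addrA [y + _]addrC subrK.
have -> : size reps = #|` seq_fset tt [seq coset x | x <- reps]|%fset.
  rewrite size_seq_fset undup_id ?size_map // map_inj_in_uniq // => x y rx ry.
  by move/cosetP; apply: inj.
rewrite /ideal_norm; congr #|` _|%fset.
rewrite -[RHS]set_fsetK; congr fset_set.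
have inS c : [set` seq_fset tt [seq coset x | x <- reps]]%classic c <->
    c \in [seq coset x | x <- reps] by rewrite -(seq_fsetE tt).
rewrite eqEsubset; split=> [_ [x Ox <-] | c /inS /mapP[x rx ->]]; last first.
  by exists x => //; apply: rO.
have [y ry axy] := cover x Ox.
apply/inS/mapP; exists y => //.
rewrite eqEsubset; split; apply: cosetE => //.
by rewrite -opprB -[- _]add0r; apply: idealB.
Qed.

Lemma eq0_multiple (m t x : int) : x = t * m -> (`|x| < `|m|)%N -> x = 0.
Proof.
move=> ->; rewrite abszM => lt; have [->|t0] := eqVneq t 0; first exact: mul0r.
by exfalso; move: lt; rewrite ltnNge leq_pmull // absz_gt0.
Qed.

Lemma distn_small (i j n : nat) : (0 <= i < 0 + n)%N -> (0 <= j < 0 + n)%N ->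
  (`|i%:Z - j%:Z| < n)%N.
Proof. lia. Qed.

(** The lattice of multiples of a + b s has a triangular basis (f, g), (m, 0)
    where g = gcd(a, b) and g m is the norm of a + b s.  So the pairs (i, j)
    with 0 <= i < |m| and 0 <= j < g represent the quotient. *)
Lemma ideal_norm_principal a b : qnorm a b != 0 ->
  ideal_norm (principal (quad a b)) = `|qnorm a b|%N.
Proof.
move=> n0.
have [p [r Bez]] : exists p r, p * a + r * b = gcdz a b.
  by case: (Bezoutz a b) => p [r E]; exists p, r.
have g_gt0 : 0 < gcdz a b.
  rewrite lt0r gcdz_eq0 andbC /=; apply: contraNN n0 => /andP[/eqP-> /eqP->].
  by rewrite /qnorm expr0n mulr0.
have [a' Da] := dvdzP (dvdz_gcdl a b); have [b' Db] := dvdzP (dvdz_gcdr a b).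
move: g_gt0 Bez Da Db; set g := gcdz a b => g_gt0 Bez Da Db.
(* With [Bez1], the pair (m, 0) and the pair (r a + 2 p b, g) are the
   triangular basis announced above. *)
have Bez1 : p * a' + r * b' = 1.
  by apply: (mulIf (lt0r_neq0 g_gt0)); rewrite mul1r -[RHS]Bez Da Db; ring.
pose m := a' * a - 2 * b' * b.
have Dn : qnorm a b = g * m by rewrite /qnorm /m Da Db; ring.
have m0 : m != 0 by apply: contraNneq n0 => m0; rewrite Dn m0 mulr0.
pose reps := [seq quad i%:Z j%:Z | i <- iota 0 `|m|, j <- iota 0 `|g|].
rewrite (@ideal_norm_reps _ reps) /reps.
- by rewrite size_allpairs !size_iota Dn abszM mulnC.
- exact: principal_ideal (integers_quad _ _).
- apply: allpairs_uniq; rewrite ?iota_uniq //.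
  by move=> [i j] [i' j'] _ _ /= /quad_inj[] [->] [->].
- by move=> _ /allpairsP[[i j] [_ _ ->]]; apply: integers_quad.
- move=> x /integersP[X [Y ->]].
  pose k := (Y %/ g)%Z; pose j := (Y %% g)%Z.
  pose X' := X - k * (r * a + 2 * p * b).
  pose l := (X' %/ m)%Z; pose i := (X' %% m)%Z.
  have EY : Y = k * g + j by exact: divz_eq.
  have EX : X' = l * m + i by exact: divz_eq.
  have i_ge0 : 0 <= i by exact: modz_ge0.
  have j_ge0 : 0 <= j by apply: modz_ge0; rewrite lt0r_neq0.
  have i_lt : i < `|m| by exact: ltz_mod.
  have j_lt : j < `|g| by apply: ltz_mod; rewrite lt0r_neq0.
  exists (quad `|i|%N `|j|%N).
    apply/allpairsP; exists (`|i|%N, `|j|%N).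
    rewrite /= !mem_iota !add0n -!ltz_nat !abszE.
    by rewrite (ger0_norm i_ge0) (ger0_norm j_ge0).
  rewrite !gez0_abs // quadB; apply/principal_quadP.
  exists (k * r + l * a'), (k * p - l * b'); split.
    rewrite (_ : X = X' + k * (r * a + 2 * p * b)); last by rewrite /X' subrK.
    by rewrite EX /m; ring.
  by rewrite EY -Bez Da Db; ring.
- move=> _ _ /allpairsP[[i j] [/= li lj ->]] /allpairsP[[i' j'] [/= li' lj' ->]].
  move: li lj li' lj'; rewrite !mem_iota => li lj li' lj'.
  rewrite quadB => /principal_quadP[u [v [EX EY]]].
  have Dj : j%:Z - j'%:Z = 0.
    apply: (@eq0_multiple g (u * b' + v * a')); last exact: distn_small.
    by rewrite EY Da Db; ring.
  have uv0 : u * b' + v * a' = 0.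
    apply: (mulIf (lt0r_neq0 g_gt0)); rewrite mul0r -Dj EY Da Db; ring.
  have Di : i%:Z - i'%:Z = 0.
    apply: (@eq0_multiple m (u * p - r * v)); last exact: distn_small.
    rewrite EX /m Da Db; apply/eqP; rewrite -subr_eq0; apply/eqP.
    transitivity ((u * b' + v * a') * (g * (a' * r + 2 * b' * p)) +
      (1 - (p * a' + r * b')) * (u * a' + 2 * v * b') * g).
      by ring.
    by rewrite uv0 Bez1; ring.
  by congr (quad _ _); lia.
Qed.

Lemma principal_unitM w w' x : ring_of_integers K w -> ring_of_integers K w' ->
  w' * w = 1 -> principal (w * x) = principal x.
Proof.
move=> Ow Ow' E; rewrite eqEsubset; split=> _ [u Ou <-].
  by exists (u * w); [exact: integersM | rewrite mulrA].
by exists (u * w'); [exact: integersM | rewrite mulrA -(mulrA u) E mulr1].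
Qed.

Lemma principal_unit_quad u v a b : qnorm u v = 1 \/ qnorm u v = -1 ->
  principal (quad (u * a + 2 * v * b) (u * b + v * a)) = principal (quad a b).
Proof.
move=> H; rewrite -quadM.
apply: (@principal_unitM _ (quad (qnorm u v * u) (- qnorm u v * v)));
  try exact: integers_quad.
have N2 : qnorm u v * qnorm u v = 1 by case: H => ->.
rewrite quadM (_ : _ + _ = qnorm u v * qnorm u v); last first.
  by rewrite [in RHS]/qnorm /qnorm; ring.
rewrite N2 (_ : _ + _ = 0); last by ring.
by rewrite /quad mul0r addr0.
Qed.

(** A fundamental domain, for the elements of odd positive norm, of the
    action of the units of norm 1. *)
Definition reduced (x y : int) := 2 * `|y| < x.

Lemma reduced_qnorm_gt0 x y : reduced x y -> 0 < qnorm x y.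
Proof.
rewrite /reduced /qnorm -[y ^+ 2]real_normK ?num_real //.
by have := normr_ge0 y; set w := `|y|; nia.
Qed.

(** Among the generators with positive norm and positive first coordinate, the
    one with the smallest first coordinate is reduced: if 2 |y| > x, then
    multiplication by 3 - 2 s or 3 + 2 s replaces x by 3 x - 4 |y|, which is
    smaller and still positive.  The boundary case x = 2 |y| has even norm. *)
Lemma exists_reduced a b : odd `|qnorm a b| ->
  exists x y, reduced x y /\ principal (quad a b) = principal (quad x y).
Proof.
move=> n_odd; set I := principal _.
have n0 : qnorm a b != 0 by apply: contraTneq n_odd => ->.
pose P n := `[< exists y : int, 0 < qnorm n%:Z y /\ I = principal (quad n%:Z y) >].
have pos c d : 0 < qnorm c d -> I = principal (quad c d) -> P `|c|%N.
  move=> n_gt0 DI; apply/asboolP; case: (lerP 0 c) => c0.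
    by exists d; rewrite gez0_abs.
  exists (- d); rewrite ltz0_abs //; split; first by rewrite /qnorm !sqrrN.
  rewrite DI -(@principal_unit_quad (-1) 0 c d); last by left.
  by rewrite !mulr0 !mul0r !addr0 !mulN1r.
have exP : exists n, P n.
  case: (ltgtP 0 (qnorm a b)) n0 => // n_lt0 _; first by exists `|a|%N; apply: (pos a b).
  exists `|(1 * a + 2 * 1 * b)%R|%N; apply: (pos _ (1 * b + 1 * a)).
    by rewrite qnormM nmulr_rgt0.
  by rewrite principal_unit_quad //; right.
case: (ex_minnP exP) => n /asboolP[y [n_gt0 DI]] n_min.
have n_neq0 : n%:Z != 0.
  apply/eqP => n00; move: n_gt0; rewrite n00 /qnorm expr0n /=.
  by have := sqr_ge0 y; lia.
have n_pos : 0 < n%:Z by lia.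
exists n%:Z, y; split=> //; rewrite /reduced ltNge; apply/negP.
rewrite le_eqVlt => /orP[/eqP Dn | lt_ny].
  have : `|qnorm a b|%N = `|qnorm n%:Z y|%N.
    rewrite -(ideal_norm_principal n0).
    by rewrite -(ideal_norm_principal (lt0r_neq0 n_gt0)) -DI.
  move: n_odd => /[swap] ->; rewrite Dn /qnorm exprMn real_normK ?num_real //.
  by rewrite (_ : _ - _ = 2 * y ^+ 2) ?abszM ?oddM //; ring.
(* Multiplication by a unit 3 + v s of norm 1, that is by 3 - 2 s or 3 + 2 s,
   cannot make the first coordinate smaller. *)
have step (v : int) : qnorm 3 v = 1 -> `|3 * n%:Z + 2 * v * y| < n%:Z -> False.
  move=> Hv lt; suff : (n <= `|(3 * n%:Z + 2 * v * y)%R|)%N by lia.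
  apply: n_min; apply: (pos _ (3 * y + v * n%:Z)).
    by rewrite qnormM Hv mul1r.
  by rewrite principal_unit_quad //; left.
move: n_gt0; rewrite /qnorm subr_gt0 => n_gt0.
case: (lerP 0 y) lt_ny => y0 lt_ny.
  by apply: (step (-2)) => //; rewrite ltr_norml; apply/andP; split; nia.
by apply: (step 2) => //; rewrite ltr_norml; apply/andP; split; nia.
Qed.

Lemma sqr_lt4 (v : int) : v ^+ 2 < 4 -> v = -1 \/ v = 0 \/ v = 1.
Proof.
move=> v2; have lo : -2 < v by nia.
have hi : v < 2 by nia.
by lia.
Qed.

Lemma pell_small (u v : int) : qnorm u v = 1 -> v ^+ 2 < 4 ->
  v = 0 /\ (u = 1 \/ u = -1).
Proof.
rewrite /qnorm => uv1 /sqr_lt4 [v1|[v1|v1]]; move: uv1; rewrite v1 => uv1.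
- by exfalso; have [||] := @sqr_lt4 u; nia.
- by split=> //; move: uv1 => /eqP; rewrite expr0n mulr0 subr0 sqrf_eq1;
    move=> /orP[] /eqP; tauto.
- by exfalso; have [||] := @sqr_lt4 u; nia.
Qed.

(** Two reduced generators differ by a unit u + v s of norm 1.  The bounds
    2 y^2 < n and x^2 < 2 n for reduced elements of norm n, applied to
    v n = y' x - x' y, give v^2 < 4, which leaves only v = 0. *)
Lemma reduced_unique x y x' y' : reduced x y -> reduced x' y' ->
  principal (quad x y) = principal (quad x' y') -> x = x' /\ y = y'.
Proof.
move=> xy xy' E; have n_gt0 := reduced_qnorm_gt0 xy.
have n'_gt0 := reduced_qnorm_gt0 xy'.
have Nn : qnorm x y = qnorm x' y'.
  have := congr1 (@ideal_norm K) E; rewrite !ideal_norm_principal ?gt_eqF //.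
  by move=> /(congr1 Posz); rewrite !gtz0_abs.
have [u [v [Ex Ey]]] : exists u v, x' = u * x + 2 * v * y /\ y' = u * y + v * x.
  apply/principal_quadP; rewrite E; exists 1; last by rewrite mul1r.
  exact: integral1.
have uv1 : qnorm u v = 1.
  by apply: (mulIf (lt0r_neq0 n_gt0)); rewrite mul1r -qnormM -Ex -Ey.
set n := qnorm x y in Nn n_gt0.
have Ev : v * n = y' * x - x' * y by rewrite Ex Ey /n /qnorm; ring.
have bound z t : reduced z t -> qnorm z t = n ->
    2 * t ^+ 2 < n /\ z ^+ 2 < 2 * n.
  rewrite /reduced /qnorm => zt <-; move: zt.
  rewrite -[t ^+ 2]real_normK ?num_real //.
  by have := normr_ge0 t; set w := `|t|; split; nia.
have [y1 x1] := bound _ _ xy erefl.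
have [y2 x2] := bound _ _ xy' (esym Nn).
have v2 : v ^+ 2 < 4.
  have n2 : 0 < n ^+ 2 by rewrite exprn_gt0.
  rewrite -(ltr_pM2r n2) -exprMn Ev.
  have A : (2 * y' ^+ 2) * x ^+ 2 < n * (2 * n).
    by apply: ltr_pM => //; [exact: mulr_ge0 _ (sqr_ge0 _) | exact: sqr_ge0].
  have B : (2 * y ^+ 2) * x' ^+ 2 < n * (2 * n).
    by apply: ltr_pM => //; [exact: mulr_ge0 _ (sqr_ge0 _) | exact: sqr_ge0].
  rewrite (_ : 4 * n ^+ 2 = n * (2 * n) + n * (2 * n)); last by ring.
  apply: le_lt_trans (ltrD A B); rewrite -subr_ge0.
  rewrite (_ : _ - _ = (y' * x + x' * y) ^+ 2) ?sqr_ge0 //; ring.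
have x_gt0 : 0 < x by apply: le_lt_trans xy; rewrite mulr_ge0.
have x'_gt0 : 0 < x' by apply: le_lt_trans xy'; rewrite mulr_ge0.
have [v0 [u1|u1]] := pell_small uv1 v2; last by exfalso; lia.
by rewrite Ex Ey u1 v0 !mul1r !mulr0 !mul0r !addr0.
Qed.
End Field.

(** * Ideals of odd norm and lattice points of the cone *)

Lemma coef_fpsMz (R : comUnitRingType) (f : fps R) (z : int) m :
  coef (f *~ z) m = coef f m *~ z.
Proof.
have Mn n : coef (f *+ n) m = coef f m *+ n.
  by elim: n => // n IH; rewrite !mulrS coef_fpsD IH.
by case: z => n; rewrite -?pmulrn ?NegzE ?mulrNz ?coef_fpsN -?pmulrn Mn.
Qed.

Lemma qnorm_cone (r i : nat) : (i < r.*2.+1)%N ->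
  qnorm r.*2.+1%:Z (i%:Z - r%:Z) = (cone_norm r i)%:Z.
Proof.
rewrite ltnS => le_i; rewrite /cone_norm /qnorm.
have : (r.*2 - i + i = r.*2)%N by exact: subnK.
move: (r.*2 - i)%N => k E.
have -> : i%:Z = 2 * r%:Z - k%:Z by lia.
have -> : (r.*2.+1)%:Z = 2 * r%:Z + 1 by lia.
have -> : ((r * r.+2 + i * k).*2.+1)%:Z
    = 2 * (r%:Z * (r%:Z + 2) + (2 * r%:Z - k%:Z) * k%:Z) + 1.
  have -> : 2 * r%:Z - k%:Z = i%:Z by lia.
  by lia.
by ring.
Qed.

(** Modulo 4 the norm is 1 - 2 j^2 with j = i - r. *)
Lemma chi4_cone_norm r i : (i < r.*2.+1)%N ->
  chi4 (cone_norm r i) = (-1) ^+ (i + r).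
Proof.
rewrite ltnS => le_i; rewrite -signr_odd /chi4 /cone_norm.
have <- : odd (r * r.+2 + i * (r.*2 - i)) = odd (i + r).
  by rewrite !oddD !oddM (oddB le_i) /= odd_double negbK /= !andbb addbC.
move: (r * r.+2 + _)%N => t; have [t_odd|t_even] := boolP (odd t).
  by have -> : (t.*2.+1 %% 4 = 3)%N by lia.
by have -> : (t.*2.+1 %% 4 = 1)%N by lia.
Qed.

Lemma cone_norm_gt r i : (r < cone_norm r i)%N.
Proof. by rewrite /cone_norm; nia. Qed.

Section Ideals.
Variables (K : fieldExtType rat) (s : K).
Hypotheses (s2 : s ^+ 2 = 2) (genK : <<1; s>>%VS = fullv).

(** The pair (r, i) stands for the cone point 2r+1 + (i - r) s. *)
Definition cone_ideal (p : nat * nat) : set K :=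
  principal (quad s p.1.*2.+1%:Z (p.2%:Z - p.1%:Z)).

Lemma cone_reduced (r i : nat) : (i < r.*2.+1)%N ->
  reduced r.*2.+1%:Z (i%:Z - r%:Z).
Proof. by rewrite /reduced; lia. Qed.

Lemma cone_idealP r i : (i < r.*2.+1)%N ->
  nonzero_ideals K (cone_ideal (r, i)) /\
  ideal_norm (cone_ideal (r, i)) = cone_norm r i.
Proof.
move=> lt_i; have n_gt0 := reduced_qnorm_gt0 (cone_reduced lt_i).
rewrite /cone_ideal (ideal_norm_principal s2 genK) ?lt0r_neq0 //= qnorm_cone //.
split=> //; split; first exact/principal_ideal/(integers_quad s2 genK).
move=> E; have : cone_ideal (r, i) (quad s r.*2.+1%:Z (i%:Z - r%:Z)).
  by exists 1; [exact: integral1 | rewrite mul1r].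
by rewrite /cone_ideal E => /(quad_eq0 s2)[].
Qed.

Lemma cone_ideal_surj (a : set K) : nonzero_ideals K a -> odd (ideal_norm a) ->
  exists r i, (i < r.*2.+1)%N /\ a = cone_ideal (r, i).
Proof.
move=> /(ideal_is_principal s2 genK)[x [y [n0 ->]]].
rewrite (ideal_norm_principal s2 genK) // => n_odd.
have [u [v [uv Euv]]] := exists_reduced s2 genK n_odd.
have u_odd : odd `|u|.
  have : `|qnorm x y|%N = `|qnorm u v|%N.
    rewrite -!(ideal_norm_principal s2 genK) ?Euv //.
    by rewrite lt0r_neq0 ?reduced_qnorm_gt0.
  move: n_odd => /[swap] ->; have [d [Dd|]] := parity_int u; last by lia.
  rewrite (_ : qnorm u v = 2 * (2 * d ^+ 2 - v ^+ 2)) ?abszM ?oddM //.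
  by rewrite /qnorm Dd; ring.
have u_gt0 : 0 < u by move: uv; rewrite /reduced; lia.
exists (`|u|%N)./2, `|(v + (`|u|%N)./2%:Z)%R|%N.
move: uv; rewrite /reduced => uv; split; first by lia.
by rewrite Euv /cone_ideal /=; congr (principal (quad _ _ _)); lia.
Qed.

Lemma cone_ideal_inj r i r' i' : (i < r.*2.+1)%N -> (i' < r'.*2.+1)%N ->
  cone_ideal (r, i) = cone_ideal (r', i') -> (r, i) = (r', i').
Proof.
move=> lt_i lt_i' E; have [] := reduced_unique s2 genK _ _ E;
  rewrite ?cone_reduced //= => E1 E2.
by congr (_, _); lia.
Qed.

(** The bound r < m loses nothing, because r < cone_norm r i. *)
Definition cone_pairs m : seq (nat * nat) :=
  [seq p <- [seq (r, i) | r <- iota 0 m, i <- iota 0 r.*2.+1]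
  | cone_norm p.1 p.2 == m].

Lemma cone_pairsP m r i :
  (r, i) \in cone_pairs m <-> (i < r.*2.+1)%N /\ cone_norm r i = m.
Proof.
rewrite mem_filter; split=> [/andP[/eqP Dm]|[lt_i Dm]].
  by move/allpairsPdep => [r' [i' [_ + [Er Ei]]]]; rewrite mem_iota -Er -Ei.
apply/andP; split; first exact/eqP.
apply/allpairsPdep; exists r, i; rewrite !mem_iota lt_i; split=> //=.
by rewrite -[X in (_ < X)%N]Dm cone_norm_gt.
Qed.

Lemma cone_pairs_uniq m : uniq (cone_pairs m).
Proof.
rewrite filter_uniq //; apply: allpairs_uniq_dep => [|r _|].
- exact: iota_uniq.
- exact: iota_uniq.
by move=> [r i] [r' i'] _ _ /= [-> ->].
Qed.

Lemma sum_cone_pairs m : coef (fps_q * f3 (fps_q ^+ 2)) m =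
  \sum_(p <- cone_pairs m) kronecker (-4) m.
Proof.
rewrite coef_q_f3 /cone_pairs big_filter.
rewrite -(big_mkord xpredT (fun r : nat =>
  \sum_(i < r.*2.+1) (-1) ^+ (i + r) * (cone_norm r i == m)%:R)).
rewrite /index_iota subn0 [RHS]big_mkcond big_allpairs_dep.
apply: eq_bigr => r _.
rewrite -(big_mkord xpredT (fun i : nat => (-1) ^+ (i + r) * (cone_norm r i == m)%:R)).
rewrite /index_iota subn0 !big_seq; apply: eq_bigr => i.
rewrite mem_iota => /= lt_i; case: eqP => [<-|_]; last by rewrite mulr0.
by rewrite mulr1 kronecker_m4 chi4_cone_norm.
Qed.

Lemma cone_pairs_image m : odd m ->
  [set cone_ideal p | p in [set` cone_pairs m]]%classic =
  (nonzero_ideals K `&` [set a | ideal_norm a = m])%classic.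
Proof.
move=> m_odd; rewrite eqEsubset; split=> [_ [[r i] /cone_pairsP[lt_i <-] <-]|a [Ia Na]].
  exact: cone_idealP.
have [|r [i [lt_i Da]]] := cone_ideal_surj Ia; first by rewrite Na.
exists (r, i); last by rewrite Da.
by apply/cone_pairsP; split=> //; rewrite -Na Da (cone_idealP lt_i).2.
Qed.

Definition ideal_term (a : set K) : fps int :=
  fps_q ^+ ideal_norm a *~ kronecker (-4) (ideal_norm a).

Lemma coef_ideal_term a m : coef (ideal_term a) m =
  if ideal_norm a == m then kronecker (-4) m else 0.
Proof.
rewrite /ideal_term coef_fpsMz coef_fps_qX eq_sym.
by case: eqP => [->|_]; [exact: intz | exact: mul0rz].
Qed.

Lemma coef_ideal_term_neq0 a m : coef (ideal_term a) m <> 0 ->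
  ideal_norm a = m /\ odd m.
Proof.
rewrite coef_ideal_term; case: eqP => // -> nz; split=> //.
apply: contra_notT nz => m_even; rewrite kronecker_m4 /chi4.
by case: eqP => [|_]; last case: eqP => //; lia.
Qed.

Lemma ideal_term_summable : fps_summable (nonzero_ideals K) ideal_term.
Proof.
move=> m.
apply: (@sub_finite_set _ _ [set cone_ideal p | p in [set` cone_pairs m]]%classic).
  move=> a [Ia /coef_ideal_term_neq0[Na m_odd]].
  by rewrite cone_pairs_image.
by apply: finite_image; apply: finite_seq.
Qed.

Lemma q_f3_ideal_sum :
  fps_q * f3 (fps_q ^+ 2) = fps_sum (nonzero_ideals K) ideal_term.
Proof.
apply/fpsP => m; rewrite sum_cone_pairs fsbig_seq ?cone_pairs_uniq //.
have [m_odd|m_even] := boolP (odd m); last first.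
  have k0 : kronecker (-4) m = 0.
    by rewrite kronecker_m4 /chi4; case: eqP => [|_]; last case: eqP => //; lia.
  rewrite [LHS]fsbig1 // [RHS]fsbig1 // => a _.
  by rewrite coef_ideal_term k0; case: ifP.
have inj : set_inj [set` cone_pairs m]%classic cone_ideal.
  move=> [r i] [r' i']; rewrite !inE => /cone_pairsP[lt_i _] /cone_pairsP[lt_i' _].
  exact: cone_ideal_inj.
transitivity (\sum_(p \in [set` cone_pairs m]%classic) coef (ideal_term (cone_ideal p)) m).
  apply: eq_fsbigr => -[r i]; rewrite inE => /cone_pairsP[lt_i Dm].
  by rewrite coef_ideal_term (cone_idealP lt_i).2 Dm eqxx.
rewrite -(@fsbig_image _ _ _ _ _ _ cone_ideal
  (fun a => coef (ideal_term a) m) inj) cone_pairs_image //.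
apply: fsbig_widen => [a [] //|a [Ia NIa]].
apply: contrapT => /coef_ideal_term_neq0[Na _].
by apply: NIa.
Qed.
End Ideals.

Theorem theorem1p3 :
  let term (a : set Qsqrt2) : fps int :=
    fps_q ^+ ideal_norm a *~ kronecker (-4) (ideal_norm a) in
  fps_summable (nonzero_ideals Qsqrt2) term /\
  fps_q * f3 (fps_q ^+ 2) = fps_sum (nonzero_ideals Qsqrt2) term.
Proof.
have [s s2 genK] := Qsqrt2_gen.
split; [exact: ideal_term_summable s2 genK | exact: q_f3_ideal_sum s2 genK].
Qed.
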